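(* Let $A\in\mathbb{R}^{N\times N}$ be symmetric and $B\in\{0,1\}^{N\times M}$, with $T_{or}$, $A_{\perp}$, $\Lambda^{\perp}$ and $\Omega_i$ as defined in the context. If $D\in\mathbb{R}^{N\times W}$ solves Problem 1, i.e., $D_{\parallel}=0$ and $(A_{\perp},D_{\perp})$ is stabilizable, then the number of rows of $D$ with at least one nonzero entry is lower bounded by $$\max_{i:\lambda_i\in\Lambda^{\perp}}|\Omega_i|_{\emptyset}+1 .$$
   Context: $\mathrm{aut}(\mathcal{G}(A,B))$ is the group of $N\times N$ permutation matrices $P$ with $PA=AP$ and $PB=B$, acting on the node set $\{1,\dots,N\}$; its orbits (clusters) $\mathcal{C}_1,\dots,\mathcal{C}_K$ partition the nodes. The group consensus subspace is $\mathcal{X}_{or}=\{x\in\mathbb{R}^N:\ x_i=x_l\ \forall i,l\in\mathcal{C}_j,\ \forall j\}$; it is $A$-invariant. $T_{or}=\begin{bmatrix} T^{\parallel} \\ T^{\perp} \end{bmatrix}\in\mathbb{R}^{N\times N}$ is an orthogonal matrix (the irreducible-representation transformation) with $T^{\parallel}\in\mathbb{R}^{K\times N}$, $T^{\parallel}_{ij}=|\mathcal{C}_i|^{-1/2}$ if $j\in\mathcal{C}_i$ and $0$ otherwise; the rows of $T^{\perp}\in\mathbb{R}^{(N-K)\times N}$ form a basis of the orthogonal complement of $\mathcal{X}_{or}$, and each row of $T^{\perp}$ has nonzero entries only at nodes of a single cluster. One has $T_{or}AT_{or}^T=\begin{bmatrix} A_{\parallel} & 0 \\ 0 & A_{\perp}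 \end{bmatrix}$. The network with additional inputs $w\in\mathbb{R}^W$ is $\dot x=Ax+Bu+Dw$ with $D\in\mathbb{R}^{N\times W}$; $D_{\parallel}=T^{\parallel}D$ and $D_{\perp}=T^{\perp}D$. Problem 1: select $D$ such that $D_{\parallel}=0$ and $(A_{\perp},D_{\perp})$ is stabilizable (usual continuous-time sense; eigenvalues with nonnegative real part count as unstable). The nodes whose rows of $D$ have a nonzero entry are the drivers. $\Lambda^{\perp}$ is the set of eigenvalues $\lambda_i$ of $A$ with nonnegative real part that are also eigenvalues of $A_{\perp}$. For $\lambda_i\in\Lambda^{\perp}$, $\Omega_i$ is the subspace of the eigenspace of $A$ for $\lambda_i$ consisting of vectors orthogonal to $\mathcal{X}_{or}$, and $|\Omega_i|$ denotes its dimension. The operator $|\cdot|_{\emptyset}$ equals $|\cdot|$ if $|\cdot|>0$ and equals $-1$ otherwise. The maximum of $|\Omega_i|_\emptyset$ over an empty $\Lambda^{\perp}$ is taken to be $-1$. *)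

(* Defs.v *)
From HB Require Import structures.
From mathcomp Require Export all_boot all_order all_algebra.
From mathcomp Require Export fingroup perm action.
From mathcomp Require Export polyrcf complex reals.

Set Implicit Arguments.
Unset Strict Implicit.
Unset Printing Implicit Defensive.

Import Order.TTheory GRing.Theory Num.Theory.
Local Open Scope ring_scope.

Section Clusters.
Variables (R : rcfType) (N M : nat) (A : 'M[R]_N) (B : 'M[R]_(N, M)).

(* A permutation matrix is represented by its underlying permutation. *)
Definition aut : {set 'S_N} :=
  [set s | (perm_mx s *m A == A *m perm_mx s) && (perm_mx s *m B == B)].

Lemma aut_group_set : group_set aut.
Proof.
apply/group_setP; split=> [|s t]; rewrite !inE.
  by rewrite perm_mx1 !mul1mx mulmx1 !eqxx.
case/andP=> /eqP sA /eqP sB /andP[/eqP tA /eqP tB].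
by rewrite perm_mxM -!mulmxA tA tB sB mulmxA sA -mulmxA !eqxx.
Qed.

Canonical aut_group := Group aut_group_set.

Definition cluster (i : 'I_N) : {set 'I_N} := orbit 'P aut i.

Definition clusters : {set {set 'I_N}} := [set cluster i | i in 'I_N].

Definition ncl : nat := #|clusters|.

(* The group consensus subspace, as a row space: the intersection of the
   hyperplanes x_i = x_l over all pairs of nodes i, l in a common cluster. *)
Definition Xor : 'M[R]_N :=
  (\bigcap_(p : 'I_N * 'I_N | p.2 \in cluster p.1)
     kermx (delta_mx p.1 0 - delta_mx p.2 0 : 'cV[R]_N))%MS.

Lemma sub_XorP (x : 'rV[R]_N) :
  reflect (forall i l, l \in cluster i -> x 0 i = x 0 l) (x <= Xor)%MS.
Proof.
have E i l : (x <= kermx (delta_mx i 0 - delta_mx l 0 : 'cV[R]_N))%MS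
             = (x 0 i == x 0 l).
  rewrite sub_kermx mulmxBr -!colE -[RHS]subr_eq0.
  apply/eqP/eqP => [/matrixP/(_ 0 0)|e]; first by rewrite !mxE.
  by apply/matrixP=> a b; rewrite !ord1 !mxE.
apply: (iffP idP) => [/sub_bigcapmxP H i l il|H].
  by apply/eqP; rewrite -E; apply: (H (i, l)).
by apply/sub_bigcapmxP=> -[i l] /= il; rewrite E; apply/eqP/H.
Qed.

Definition Xor_perp : 'M[R]_N := kermx Xor^T.

Lemma sub_Xor_perpP (v : 'rV[R]_N) :
  reflect (forall x : 'rV[R]_N, (x <= Xor)%MS -> v *m x^T = 0)
          (v <= Xor_perp)%MS.
Proof.
rewrite sub_kermx; apply: (iffP eqP) => [vX x /submxP[c ->]|vX].
  by rewrite trmx_mul mulmxA vX mul0mx.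
apply/trmx_inj/row_matrixP => i.
rewrite trmx_mul trmxK trmx0 row0 row_mul; apply/trmx_inj.
by rewrite trmx_mul trmxK trmx0 vX // row_sub.
Qed.

(* The clusters are numbered by [enum_val]. *)
Definition T_par : 'M[R]_(ncl, N) :=
  \matrix_(i, j) (let C := enum_val i : {set 'I_N} in
                  if j \in C then (Num.sqrt #|C|%:R)^-1 else 0).

(* Both products are required because ncl + (N - ncl) and N, although equal,
   are not convertible. *)
Record is_Tor (T : 'M[R]_(ncl + (N - ncl), N)) : Prop := IsTor {
  Tor_mul_tr : T *m T^T = 1%:M;
  Tor_tr_mul : T^T *m T = 1%:M;
  Tor_par : usubmx T = T_par;
  Tor_perp_free : row_free (dsubmx T);
  Tor_perp_span : (dsubmx T == Xor_perp)%MS;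
  Tor_perp_single : forall r : 'I_(N - ncl), exists2 C : {set 'I_N},
    C \in clusters & forall j, dsubmx T r j != 0 -> j \in C
}.

Section Transformed.
Variable T : 'M[R]_(ncl + (N - ncl), N).

Definition A_perp : 'M[R]_(N - ncl) := drsubmx (T *m A *m T^T).

Definition D_par W (D : 'M[R]_(N, W)) : 'M[R]_(ncl, W) := usubmx T *m D.

Definition D_perp W (D : 'M[R]_(N, W)) : 'M[R]_(N - ncl, W) := dsubmx T *m D.

(* For symmetric A all complex eigenvalues are real (lemma
   [symmetric_eigenvalue_real] below), so "nonnegative real part" reads 0 <= l
   and the eigenvalues are the roots in R of the characteristic polynomial. *)
Definition Lambda_perp : seq R :=
  [seq l <- rootsR (char_poly A) | (0 <= l) && eigenvalue A_perp l].

Lemma mem_Lambda_perp l :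
  (l \in Lambda_perp) = [&& eigenvalue A l, 0 <= l & eigenvalue A_perp l].
Proof.
have nz : char_poly A != 0 by rewrite monic_neq0 // char_poly_monic.
rewrite mem_filter andbC; congr (_ && _); rewrite eigenvalue_root_char.
by have := roots_on_rootsR nz l; rewrite in_itv /= => <-.
Qed.

End Transformed.

(* Mathcomp's [eigenspace] consists of row vectors v with v *m g = l *: v;
   applied to A^T it gives the transposes of the column eigenvectors of A. *)
Definition Omega (l : R) : 'M[R]_N := (eigenspace A^T l :&: Xor_perp)%MS.

End Clusters.

Definition cplx_mx (R : rcfType) m n (X : 'M[R]_(m, n)) : 'M[R[i]]_(m, n) :=
  map_mx (real_complex R) X.

Definition hurwitz (R : rcfType) n (X : 'M[R]_n) : Prop :=
  forall z : R[i], eigenvalue (cplx_mx X) z -> complex.Re z < 0.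

Definition stabilizable (R : rcfType) n m (A : 'M[R]_n) (B : 'M[R]_(n, m)) :=
  exists F : 'M[R]_(m, n), hurwitz (A + B *m F).

Definition solves_problem1 (R : rcfType) N M W (A : 'M[R]_N)
    (B : 'M[R]_(N, M)) (T : 'M[R]_(ncl A B + (N - ncl A B), N))
    (D : 'M[R]_(N, W)) : Prop :=
  D_par T D = 0 /\ stabilizable (A_perp T) (D_perp T D).

Definition drivers (R : rcfType) N W (D : 'M[R]_(N, W)) : {set 'I_N} :=
  [set i | [exists j, D i j != 0]].

(* The operator written with a subscript empty set, applied to a dimension. *)
Definition dim_or_m1 (d : nat) : int := if (0 < d)%N then d%:Z else -1.

Definition max_Omega (R : rcfType) N M (A : 'M[R]_N) (B : 'M[R]_(N, M))
    (T : 'M[R]_(ncl A B + (N - ncl A B), N)) : int :=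
  \big[Order.max/-1]_(l <- Lambda_perp T) dim_or_m1 (\rank (Omega A B l)).

Lemma symmetric_eigenvalue_real (R : rcfType) n (A : 'M[R]_n) (z : R[i]) :
  A^T = A -> eigenvalue (cplx_mx A) z -> complex.Im z = 0.
Proof.
move=> symA /eigenvalueP[v vA v0].
pose w : 'cV[R[i]]_n := map_mx Num.conj v^T.
have wA : cplx_mx A *m w = Num.conj z *: w.
  rewrite /w -map_mxZ -linearZ /= -vA trmx_mul map_mxM.
  congr (_ *m _); apply/matrixP=> i j; rewrite !mxE.
  by rewrite -{1}symA mxE; apply/eqP; rewrite eq_complex /= oppr0 !eqxx.
have: v *m cplx_mx A *m w = v *m (cplx_mx A *m w) by rewrite mulmxA.
rewrite vA wA -scalemxAl -scalemxAr => /eqP.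
rewrite -subr_eq0 -scalerBl scaler_eq0 subr_eq0 => zs.
have {zs} : z = Num.conj z.
  apply/eqP; case/orP: zs => // /eqP/matrixP/(_ 0 0) s0.
  move: s0; rewrite !mxE => s0; case/negP: v0.
  apply/eqP/matrixP=> i j; rewrite ord1 mxE; apply/eqP.
  have /psumr_eq0P/(_ s0)/(_ j isT) : forall k : 'I_n,
      true -> 0 <= v 0 k * w k 0 by move=> k _; rewrite !mxE mul_conjC_ge0.
  by rewrite !mxE => /eqP; rewrite mul_conjC_eq0.
case: z {vA wA} => a b /eqP; rewrite eq_complex /= => /andP[_].
by rewrite -addr_eq0 -mulr2n mulrn_eq0 /= => /eqP.
Qed.

(* Main.v *)
Require Import Defs.
From mathcomp Require Import all_boot all_order all_algebra.
From mathcomp Require Import reals.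
Import Order.TTheory GRing.Theory Num.Theory.
Local Open Scope ring_scope.

(** Fix an eigenvalue [l] of [A] in [Lambda_perp], and suppose that
    [Omega A B l] is nonzero; the values of [l] with [Omega A B l] zero
    contribute [-1] to the maximum, where there is nothing to prove.  The
    bound is the chain
    [\rank (Omega A B l) <= \rank D <= #|drivers D| - 1].

    The first inequality is the easy half of the Popov-Belevitch-Hautus test.
    In the coordinates given by the rows of [dsubmx T], a nonzero vector
    of [Omega] becomes a left eigenvector of [A_perp T] for [l >= 0]; if it were killed
    by [D], it would remain a left eigenvector for [l] of every closed loop
    [A_perp T + D_perp T D *m F], so no feedback would be stabilizing
    ([stabilizable_left_eigenvector], [Omega_mulmx_eq0]).  Hence right
    multiplication by [D] is injective on [Omega].

    The second inequality comes from [D_par T D = 0].  Since [D] is nonzero,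
    there is a driver; the column sums of [D] over its cluster vanish, which
    is a nontrivial linear relation between the nonzero rows of [D]
    ([mxrank_lt_card_support]). *)

(** A relation between the rows of [D] that involves a row in [S] restricts to
    a nontrivial relation between the rows in [S], the other ones being zero;
    so the rows in [S], which span the row space, are linearly dependent. *)
Lemma mxrank_lt_card_support {F : fieldType} {m n : nat} (D : 'M[F]_(m, n))
    (S : {set 'I_m}) (u : 'rV[F]_m) (i : 'I_m) :
  (forall j, j \notin S -> row j D = 0) ->
  u *m D = 0 -> i \in S -> u 0 i != 0 -> (\rank D < #|S|)%N.
Proof.
move=> D0 uD iS ui0.
pose f (k : 'I_#|S|) : 'I_m := enum_val k.
have restr (p : nat) (v : 'M_(p, m)) : v *m D = colsub f v *m rowsub f D.
  apply/matrixP=> a b; rewrite !mxE (bigID (mem S)) /= addrC big1 => [|j jS].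
    rewrite add0r big_enum_val /=.
    by apply: eq_bigr => k _; rewrite !mxE.
  by have /rowP/(_ b) := D0 j jS; rewrite !mxE => ->; rewrite mulr0.
have le_DS : (\rank D <= \rank (rowsub f D))%N.
  by rewrite -{1}[D]mul1mx restr mxrankM_maxr.
apply: leq_ltn_trans le_DS _.
rewrite ltn_neqAle rank_leq_row andbT.
apply: contra ui0 => free_S; apply/eqP.
have /rowP/(_ (enum_rank_in iS i)) : colsub f u = 0.
  by apply: (row_free_inj free_S); rewrite mul0mx -restr.
by rewrite !mxE /f enum_rankK_in.
Qed.

(** A left eigenvector of [A] killed by [B] is a left eigenvector, for the
    same eigenvalue, of [A + B *m F] whatever the feedback [F]. *)
Lemma stabilizable_left_eigenvector {R : rcfType} {n m : nat}
    {A : 'M[R]_n} {B : 'M[R]_(n, m)} {l : R} (c : 'rV[R]_n) :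
  stabilizable A B -> 0 <= l -> c *m A = l *: c -> c *m B = 0 -> c = 0.
Proof.
case=> F hurF l0 cA cB; apply/eqP; apply: contraLR l0 => c0.
have evF : eigenvalue (A + B *m F) l.
  by apply/eigenvalueP; exists c; rewrite // mulmxDr mulmxA cB mul0mx addr0.
by rewrite -ltNge; apply: (hurF l%:C%C); rewrite eigenvalue_map.
Qed.

Section Drivers.
Context {R : realType} {N M W : nat}.
Context {A : 'M[R]_N} {B : 'M[R]_(N, M)}.
Context {T : 'M[R]_(ncl A B + (N - ncl A B), N)} {D : 'M[R]_(N, W)}.
Hypothesis HT : is_Tor T.

Lemma Tor_perp_orthonormal : dsubmx T *m (dsubmx T)^T = 1%:M.
Proof.
have := Tor_mul_tr HT.
rewrite -{1 2}[T]vsubmxK tr_col_mx mul_col_row scalar_mx_block.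
by case/eq_block_mx.
Qed.

Lemma A_perpE : A_perp T = dsubmx T *m A *m (dsubmx T)^T.
Proof.
rewrite /A_perp -{1 2}[T]vsubmxK tr_col_mx mul_col_mx mul_col_row.
by rewrite block_mxKdr.
Qed.

Lemma Omega_mulmx_eq0 {l : R} {v : 'rV[R]_N} :
    A^T = A -> stabilizable (A_perp T) (D_perp T D) -> 0 <= l ->
  (v <= Omega A B l)%MS -> v *m D = 0 -> v = 0.
Proof.
move=> symA stabD l0; rewrite sub_capmx symA => /andP[/eigenspaceP vA].
rewrite -(eqmxP (Tor_perp_span HT)) => /submxP[c vE] vD.
rewrite vE (stabilizable_left_eigenvector c stabD l0) ?mul0mx //.
  rewrite A_perpE !mulmxA -vE vA -scalemxAl vE -mulmxA.
  by rewrite Tor_perp_orthonormal mulmx1.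
by rewrite mulmxA -vE.
Qed.

(** The relation used is the row of [T_par A B] at the cluster of a driver. *)
Lemma mxrank_lt_drivers :
  D_par T D = 0 -> D != 0 -> (\rank D < #|drivers D|)%N.
Proof.
move=> Dpar /matrix0Pn[i [k Dik]].
have iC : cluster A B i \in clusters A B by apply: imset_f.
pose r := enum_rank_in iC (cluster A B i).
have rE : enum_val r = cluster A B i by rewrite enum_rankK_in.
have i_i : i \in cluster A B i by apply: orbit_refl.
apply: (mxrank_lt_card_support D (drivers D) (row r (T_par A B)) i).
- move=> j; rewrite inE negb_exists => /forallP Dj.
  by apply/rowP=> b; rewrite !mxE; apply/eqP; rewrite -[_ == _]negbK Dj.
- by rewrite -row_mul -(Tor_par HT) -/(D_par T D) Dpar row0.
- by rewrite inE; apply/existsP; exists k.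
- rewrite !mxE /= rE i_i invr_eq0 gt_eqF // sqrtr_gt0 ltr0n card_gt0.
  by apply/set0Pn; exists i.
Qed.

Lemma rank_Omega_lt_drivers {l : R} :
    A^T = A -> solves_problem1 T D -> 0 <= l ->
  (0 < \rank (Omega A B l))%N -> (\rank (Omega A B l) < #|drivers D|)%N.
Proof.
move=> symA [Dpar stabD] l0 Om0.
have injD : (Omega A B l :&: kermx D)%MS = 0.
  apply/eqP/rowV0P => v; rewrite sub_capmx sub_kermx => /andP[vOm /eqP].
  exact: (Omega_mulmx_eq0 symA stabD l0 vOm).
have le_rD : (\rank (Omega A B l) <= \rank D)%N.
  by rewrite -(mxrank_mul_ker _ D) injD mxrank0 addn0 mxrankM_maxr.
apply: (leq_ltn_trans le_rD); apply: mxrank_lt_drivers => //.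
by rewrite -mxrank_eq0 -lt0n (leq_trans Om0).
Qed.

End Drivers.

Theorem corollary4 (R : realType) (N M W : nat)
    (A : 'M[R]_N) (B : 'M[R]_(N, M))
    (T : 'M[R]_(ncl A B + (N - ncl A B), N)) (D : 'M[R]_(N, W))
    (symA : A^T = A)
    (binB : forall i j, B i j = 0 \/ B i j = 1)
    (HT : is_Tor T)
    (HD : solves_problem1 T D) :
  max_Omega T + 1 <= #|drivers D|%:Z.
Proof.
have ge_m1 : -1 <= #|drivers D|%:Z - 1 by rewrite lerBrDr addNr.
rewrite -lerBrDr /max_Omega big_seq; apply: bigmax_le => // l.
rewrite mem_Lambda_perp => /and3P[_ l0 _].
rewrite /dim_or_m1; case: ifP => // Om0.
by rewrite lerBrDr -PoszD addn1 lez_nat (rank_Omega_lt_drivers HT).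
Qed.
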